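(* Let $M\ge N\ge K\ge 2$ and let $F:(\mathbb{R}^M,0)\to(\mathbb{R}^N,0)$ and $G:(\mathbb{R}^N,0)\to(\mathbb{R}^K,0)$ be analytic map germs with $F$ tame, $\mathrm{Disc}\,F=\{0\}$ and $\mathrm{Sing}\,G\subseteq V_G$. Let $H=G\circ F$ and suppose that $F(M(H))\subseteq M(G)$ as germs of sets at the origin. If $G$ is tame, then $H$ is tame.
   Context: All analytic map germs are non-constant; a germ and its representatives are denoted by the same symbol, and all sets are considered as germs at the origin. For a map germ $F:(\mathbb{R}^M,0)\to(\mathbb{R}^N,0)$, put $V_F=F^{-1}(0)$ and let $\mathrm{Sing}\,F$ be the set of points $x$ where the Jacobian matrix $\mathrm{d}F(x)$ does not have maximal rank (rank less than the target dimension $N$, i.e. $F$ is not a submersion at $x$). $\mathrm{Disc}\,F=F(\mathrm{Sing}\,F)$. The condition $\mathrm{Disc}\,F=\{0\}$ (isolated critical value at the origin) means $\mathrm{Sing}\,F\subseteq V_F$. Let $\rho_E(x)=\|x\|^2$. The Milnor set of $F$ is $M(F)=\mathrm{Sing}(F,\rho_E)$, the set of points where $(F,\rho_E)$ is not a submersion to $\mathbb{R}^{N+1}$; in particular $\mathrm{Sing}\,F\subseteq M(F)$. $F$ is tame if $\overline{M(F)\setminus V_F}\cap V_F\subseteq\{0\}$ as set germs at the origin. The same notation is used for $G$ and $H$. In forming images under $F$, $M(H)$ stands for $M(H)\cap\bar B_\epsilon$, where $\bar B_\epsilon$ is the closed ball of radius $\epsilon$ about the origin of $\mathbb{R}^M$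 and $\epsilon>0$ is arbitrary but small enough. *)

(* Defs.v *)
From HB Require Import structures.
From mathcomp Require Import all_boot all_order all_algebra.
From mathcomp Require Import all_classical all_reals all_analysis.
From mathcomp Require Import showcase.summability.
Import Order.TTheory GRing.Theory Num.Theory.
Import numFieldNormedType.Exports.

Set Implicit Arguments.
Unset Strict Implicit.
Unset Printing Implicit Defensive.

Local Open Scope classical_set_scope.
Local Open Scope ring_scope.

Section MapGerms.
Context {R : realType}.

Definition monomial m (x : 'rV[R]_m) (k : {ffun 'I_m -> nat}) : R :=
  \prod_(i < m) x 0 i ^+ k i.

(* Sums over the countable set of multi-indices are unordered: [partial_sum t]
   sends a finite set of multi-indices to the corresponding finite sum of [t],
   and [totally] is the filter of large finite sets, so convergence here is
   unconditional (equivalently, absolute). *)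
Definition analytic_at m (f : 'rV[R]_m -> R) (a : 'rV[R]_m) : Prop :=
  exists c : {ffun 'I_m -> nat} -> R, \forall x \near a,
    partial_sum (fun k => c k * monomial (x - a) k) @ totally --> f x.

(* A germ (R^m, 0) -> (R^n, 0) is given by a total function representing it;
   the values of the representative far from 0 are irrelevant. *)
Definition analytic_germ m n (F : 'rV[R]_m -> 'rV[R]_n) : Prop :=
  [/\ F 0 = 0,
      (forall j : 'I_n, analytic_at (fun x => F x 0 j) 0) &
      ~ (\forall x \near (0 : 'rV[R]_m), F x = F 0)].

Definition germ_subset n (A B : set 'rV[R]_n) : Prop :=
  \forall x \near (0 : 'rV[R]_n), A x -> B x.

Definition zero_set m n (F : 'rV[R]_m -> 'rV[R]_n) : set 'rV[R]_m :=
  F @^-1` [set 0].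

(* ['J F x] acts on row vectors, so it is the transpose of the usual Jacobian
   matrix and has the same rank. *)
Definition Sing m n (F : 'rV[R]_m -> 'rV[R]_n) : set 'rV[R]_m :=
  [set x | (\rank ('J F x) < n)%N].

(* Disc F = {0}, i.e. F (Sing F) reduces to the origin. *)
Definition isolated_critical_value m n (F : 'rV[R]_m -> 'rV[R]_n) : Prop :=
  germ_subset (Sing F) (zero_set F).

(* The norm of ['rV[R]_m] in the library is the sup norm, hence the explicit
   Euclidean expression. *)
Definition rhoE m (x : 'rV[R]_m) : R := \sum_(i < m) x 0 i ^+ 2.

Definition closed_Eball m (eps : R) : set 'rV[R]_m :=
  [set x | Num.sqrt (rhoE x) <= eps].

Definition Milnor_set m n (F : 'rV[R]_m -> 'rV[R]_n) : set 'rV[R]_m :=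
  Sing (fun x => row_mx (F x) (rhoE x)%:M : 'rV[R]_(n + 1)).

Definition tame m n (F : 'rV[R]_m -> 'rV[R]_n) : Prop :=
  germ_subset (closure (Milnor_set F `\` zero_set F) `&` zero_set F) [set 0].

End MapGerms.

(* Main.v *)
(** Let [p <> 0] be a zero of [H = G o F] close to the origin, and a limit of
    points [x] of [M(H)] with [H x <> 0].  If [F p <> 0], then [F p] is a zero
    of [G] and the limit of the points [F x], which lie in [M(G)] and off [V_G];
    this contradicts the tameness of [G].  If [F p = 0], note that [G] is a
    submersion at [F x] (as [Sing G] lies in [V_G]), so that [x] in [M(H)]
    forces [x] in [M(F)]; moreover [F x <> 0], and this contradicts the tameness
    of [F].

    The chain rule used here needs analytic germs to be differentiable near the
    origin, while analyticity is only given as the convergence of one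
    unconditional power series.  All its finite partial sums satisfy one and the
    same second order Taylor estimate with bounded linear parts, and an
    ultrafilter limit of these linear parts is the differential of the sum. *)
From HB Require Import structures.
Require Import Defs.
From mathcomp Require Import all_boot all_order all_algebra.
From mathcomp Require Import finmap.
From mathcomp Require Import all_classical all_reals all_analysis.
From mathcomp Require Import ring lra.
From mathcomp Require Import showcase.summability.
Import Order.TTheory GRing.Theory Num.Theory.
Import numFieldNormedType.Exports.

Local Open Scope classical_set_scope.
Local Open Scope ring_scope.

(** * Differentiability criterion and images of ultrafilters *)

Lemma differentiable_quadratic (R : realFieldType) (V W : normedModType R)
    (f : V -> W) (x : V) (L : {linear V -> W}) (C : R) :
  continuous L ->
  (\forall h \near 0, `|f (x + h) - f x - L h| <= C * `|h| ^+ 2) ->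
  differentiable f x.
Proof.
move=> Lc fL.
have fE : f \o shift x = cst (f x) + L +o_ 0 id.
  apply/eqaddoP => _/posnumP[e].
  have Csmall : \forall h \near (0 : V), `|C| * `|h| <= e%:num.
    have [->|C0] := eqVneq C 0; first by near=> h; rewrite normr0 mul0r.
    near=> h; rewrite -ler_pdivlMl ?normr_gt0//; near: h.
    by apply: nbhs0_le; rewrite mulr_gt0// invr_gt0 normr_gt0.
  near=> h.
  rewrite /= opprD addrA.
  apply: (@le_trans _ _ (C * `|h| ^+ 2)).
    have -> : (f \o shift x - cst (f x) - (L : V -> W)) h = f (x + h) - f x - L h.
      by rewrite [x + h]addrC.
    by near: h.
  rewrite expr2 mulrA ler_wpM2r//; apply: le_trans (_ : `|C| * `|h| <= _).
    by rewrite ler_wpM2r// ler_norm.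
  by near: h; exact: Csmall.
by apply/diff_locallyP; rewrite (diff_unique Lc fE).
Unshelve. all: by end_near. Qed.

(** An ultrafilter contains every preimage or its complement, so the image filter decides every set
    [B] and has no proper refinement. *)
Lemma ultra_fmap (T U : Type) (f : T -> U) (F : set_system T) :
  UltraFilter F -> UltraFilter (f @ F).
Proof.
move=> UF; split; first exact: fmap_proper_filter.
move=> G PG FG; apply/seteqP; split => [B GB|]; last exact: FG.
have [//|FnB] := in_ultra_setVsetC (f @^-1` B) UF.
have GnB : G (~` B) by exact: FG.
by have [x []] := filter_ex (filterI GB GnB).
Qed.

(** * Second order Taylor estimates with explicit constants *)

Section quad.
Context {R : realType} {m : nat}.
Implicit Types (g : 'rV[R]_m -> R) (x v l h : 'rV[R]_m).

(** Linear forms are kept as coefficient vectors [l], so that a bounded family of them lies in a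
    compact box. *)
Definition dotv v l : R := (v *m l^T) 0 0.

Lemma dotvE v l : dotv v l = \sum_i v 0 i * l 0 i.
Proof. by rewrite /dotv mxE; apply: eq_bigr => i _; rewrite mxE. Qed.

Lemma dotv_continuous l : continuous (fun v => dotv v l).
Proof.
rewrite (_ : (fun v => dotv v l) = fun v => \sum_j v 0 j * l 0 j); last first.
  by apply/funext => v; exact: dotvE.
apply: continuous_big => [|j _]; first exact: add_continuous.
move=> v; apply: (@continuousM _ _ (fun v : 'rV[R]_m => v 0 j) (cst (l 0 j)) v).
  exact: coord_continuous.
exact: cst_continuous.
Qed.

Lemma le_coord_norm v i : `|v 0 i| <= `|v|.
Proof.
by rewrite [leRHS]/Num.norm /= mx_normrE; apply/bigmax_geP; right => /=; exists (0, i).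
Qed.

(* [a], [b], [c] bound the value, the linear part and the quadratic remainder.
   Bounding the combination [a + b eta + c eta^2] makes the constant [A]
   multiplicative, so that a monomial satisfies the estimate with its value at
   the point whose coordinates all equal the sum of the two radii. *)
Definition quad_bound (eta A : R) g x : Prop :=
  exists l : 'rV[R]_m, exists a b c : R,
  [/\ [/\ 0 <= a, 0 <= b & 0 <= c], a + b * eta + c * eta ^+ 2 <= A,
     `|g x| <= a,
     forall v, `|dotv v l| <= b * `|v| &
     forall h, `|h| <= eta -> `|g (x + h) - g x - dotv h l| <= c * `|h| ^+ 2].

Context (eta : R) (x : 'rV[R]_m) (eta0 : 0 < eta).
Notation T := (quad_bound eta).

Lemma dotvD v l l' : dotv v (l + l') = dotv v l + dotv v l'.
Proof. by rewrite /dotv linearD mulmxDr mxE. Qed.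

Lemma dotvZ v k l : dotv v (k *: l) = k * dotv v l.
Proof. by rewrite /dotv linearZ -scalemxAr mxE. Qed.

Lemma quad_boundD A A' g g' :
  T A g x -> T A' g' x -> T (A + A') (fun y => g y + g' y) x.
Proof.
move=> [l [a [b [c [[a0 b0 c0] sA ga lb rc]]]]].
move=> [l' [a' [b' [c' [[a'0 b'0 c'0] sA' ga' lb' rc']]]]].
exists (l + l'), (a + a'), (b + b'), (c + c'); split.
- by split; apply: addr_ge0.
- lra.
- by rewrite (le_trans (ler_normD _ _))// lerD.
- move=> v; rewrite dotvD (le_trans (ler_normD _ _))// mulrDl lerD//.
- move=> h hh; rewrite dotvD.
  have -> : g (x + h) + g' (x + h) - (g x + g' x) - (dotv h l + dotv h l') =
    (g (x + h) - g x - dotv h l) + (g' (x + h) - g' x - dotv h l') by ring.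
  by rewrite (le_trans (ler_normD _ _))// mulrDl lerD// ?rc ?rc'.
Qed.

Lemma quad_boundZ A g (k : R) : T A g x -> T (`|k| * A) (fun y => k * g y) x.
Proof.
move=> [l [a [b [c [[a0 b0 c0] sA ga lb rc]]]]].
exists (k *: l), (`|k| * a), (`|k| * b), (`|k| * c); split.
- by split; apply: mulr_ge0.
- by rewrite -!mulrA -!mulrDr ler_wpM2l.
- by rewrite normrM ler_wpM2l.
- by move=> v; rewrite dotvZ normrM -mulrA ler_wpM2l.
- move=> h hh; rewrite dotvZ.
  by rewrite -!mulrBr normrM -mulrA ler_wpM2l// rc.
Qed.

Lemma quad_bound_cst (k : R) : T `|k| (fun=> k) x.
Proof.
exists 0, `|k|, 0, 0; split => //; first by rewrite !mul0r !addr0.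
- by move=> v; rewrite /dotv linear0 mulmx0 mxE normr0 mul0r.
- by move=> h _; rewrite subrr /dotv linear0 mulmx0 mxE subr0 normr0 mul0r.
Qed.

Lemma quad_bound_coord i (s : R) : `|x| <= s -> T (s + eta) (fun y => y 0 i) x.
Proof.
move=> xs.
have dE v : dotv v (delta_mx 0 i) = v 0 i.
  rewrite dotvE (bigD1 i)//= mxE !eqxx mulr1 big1 ?addr0// => j ji.
  by rewrite mxE (negbTE ji) andbF mulr0.
exists (delta_mx 0 i), s, 1, 0; split.
- by split => //; exact: le_trans xs.
- by rewrite mul1r mul0r addr0.
- exact: le_trans (le_coord_norm _ _) xs.
- by move=> v; rewrite dE mul1r le_coord_norm.
- by move=> h _; rewrite dE mxE mul0r (_ : _ - _ - _ = 0) ?normr0//; ring.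
Qed.

(** The linear part follows the Leibniz rule; the terms of order three and four in [h] are absorbed
    into the quadratic one through [|h| <= eta]. *)
Lemma quad_boundM A A' g g' :
  T A g x -> T A' g' x -> T (A * A') (fun y => g y * g' y) x.
Proof.
move=> [l [a [b [c [[a0 b0 c0] sA ga lb rc]]]]].
move=> [l' [a' [b' [c' [[a'0 b'0 c'0] sA' ga' lb' rc']]]]].
have e0 := ltW eta0.
(* With these coefficients the new combination is exactly the product of the two old ones. *)
exists (g x *: l' + g' x *: l), (a * a'), (a * b' + b * a'),
  (b * b' + a * c' + c * a' + (b * c' + c * b') * eta + c * c' * eta ^+ 2); split.
- by split; rewrite ?addr_ge0 ?mulr_ge0 ?exprn_ge0// ?addr_ge0 ?mulr_ge0.
- apply: le_trans (_ :
      (a + b * eta + c * eta ^+ 2) * (a' + b' * eta + c' * eta ^+ 2) <= _).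
    by rewrite le_eqVlt; apply/orP; left; apply/eqP; ring.
  by rewrite ler_pM// !addr_ge0// ?mulr_ge0 ?exprn_ge0.
- by rewrite normrM ler_pM.
- move=> v; rewrite dotvD !dotvZ (le_trans (ler_normD _ _))// mulrDl !normrM.
  rewrite lerD// -mulrA; first by rewrite ler_pM.
  by rewrite [leRHS]mulrCA ler_pM.
- move=> h hh; rewrite dotvD !dotvZ.
  set r := g (x + h) - g x - dotv h l; set r' := g' (x + h) - g' x - dotv h l'.
  set u := dotv h l; set u' := dotv h l'.
  have -> : g (x + h) * g' (x + h) - g x * g' x - (g x * u' + g' x * u) =
     u * u' + g x * r' + r * g' x + (u * r' + r * u') + r * r'.
    by rewrite /r /r' /u /u'; ring.
  have Hr : `|r| <= c * `|h| ^+ 2 by exact: rc.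
  have Hr' : `|r'| <= c' * `|h| ^+ 2 by exact: rc'.
  have Hu : `|u| <= b * `|h| by exact: lb.
  have Hu' : `|u'| <= b' * `|h| by exact: lb'.
  have D y z Y Z : `|y| <= Y -> `|z| <= Z -> `|y + z : R| <= Y + Z.
    by move=> ? ?; rewrite (le_trans (ler_normD _ _))// lerD.
  have P y z Y Z : `|y| <= Y -> `|z| <= Z -> `|y * z : R| <= Y * Z.
    by move=> ? ?; rewrite normrM ler_pM.
  have := D _ _ _ _ (D _ _ _ _ (D _ _ _ _ (D _ _ _ _ (P _ _ _ _ Hu Hu')
     (P _ _ _ _ ga Hr')) (P _ _ _ _ Hr ga'))
     (D _ _ _ _ (P _ _ _ _ Hu Hr') (P _ _ _ _ Hr Hu'))) (P _ _ _ _ Hr Hr').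
  move=> /le_trans; apply.
  have -> : b * `|h| * (b' * `|h|) + a * (c' * `|h| ^+ 2) + c * `|h| ^+ 2 * a' +
   (b * `|h| * (c' * `|h| ^+ 2) + c * `|h| ^+ 2 * (b' * `|h|)) +
   c * `|h| ^+ 2 * (c' * `|h| ^+ 2) =
   (b * b' + a * c' + c * a' + (b * c' + c * b') * `|h| + c * c' * `|h| ^+ 2) * `|h| ^+ 2.
    by ring.
  rewrite ler_wpM2r ?exprn_ge0// !lerD// ler_wpM2l ?addr_ge0 ?mulr_ge0//.
  by rewrite ler_pXn2r// nnegrE.
Qed.

Lemma quad_bound_sum (I : Type) (r : seq I) (A : I -> R)
    (g : I -> 'rV[R]_m -> R) :
  (forall i, T (A i) (g i) x) ->
  T (\sum_(i <- r) A i) (fun y => \sum_(i <- r) g i y) x.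
Proof.
move=> Tg; elim: r => [|j r IHr].
  rewrite big_nil -[X in T X](@normr0 R R).
  have -> : (fun y => \sum_(i <- [::]) g i y) = fun=> 0.
    by apply/funext => y; rewrite big_nil.
  exact: quad_bound_cst.
rewrite big_cons.
have -> : (fun y => \sum_(i <- j :: r) g i y) = fun y => g j y + \sum_(i <- r) g i y.
  by apply/funext => y; rewrite big_cons.
exact: quad_boundD.
Qed.

Lemma quad_bound_prod (I : Type) (r : seq I) (A : I -> R)
    (g : I -> 'rV[R]_m -> R) :
  (forall i, T (A i) (g i) x) ->
  T (\prod_(i <- r) A i) (fun y => \prod_(i <- r) g i y) x.
Proof.
move=> Tg; elim: r => [|j r IHr].
  rewrite big_nil -[X in T X](@normr1 R).
  have -> : (fun y => \prod_(i <- [::]) g i y) = fun=> 1.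
    by apply/funext => y; rewrite big_nil.
  exact: quad_bound_cst.
rewrite big_cons.
have -> : (fun y => \prod_(i <- j :: r) g i y) = fun y => g j y * \prod_(i <- r) g i y.
  by apply/funext => y; rewrite big_cons.
exact: quad_boundM.
Qed.

Lemma quad_boundX A g n : T A g x -> T (A ^+ n) (fun y => g y ^+ n) x.
Proof.
move=> Tg; elim: n => [|n IHn]; last first.
  have -> : (fun y => g y ^+ n.+1) = fun y => g y * g y ^+ n.
    by apply/funext => y; rewrite exprS.
  by rewrite exprS; exact: quad_boundM Tg IHn.
by rewrite -[X in T X](@normr1 R); exact: quad_bound_cst.
Qed.

Lemma quad_bound_monomial (s : R) (k : {ffun 'I_m -> nat}) : `|x| <= s ->
  T (monomial (const_mx (s + eta)) k) (fun y => monomial y k) x.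
Proof.
move=> xs; apply: quad_bound_prod => i; rewrite mxE; apply: quad_boundX.
exact: quad_bound_coord.
Qed.

(** The common bound [A] confines all linear parts to one compact box. Their convergence along [F]
    is not known, but they converge along a finer ultrafilter, and the quadratic estimate passes to
    the limit. *)
Lemma quad_bound_lim (I : Type) (F : set_system I) {FF : ProperFilter F}
    (g : I -> 'rV[R]_m -> R) (A : R) (f : 'rV[R]_m -> R) :
  (forall i, T A (g i) x) ->
  (forall h, `|h| <= eta -> g ^~ (x + h) @ F --> f (x + h)) ->
  exists l, forall h, `|h| <= eta ->
    `|f (x + h) - f x - dotv h l| <= A / eta ^+ 2 * `|h| ^+ 2.
Proof.
move=> Tg gf.
have {}Tg i : exists l : 'rV[R]_m, (forall j, `|l 0 j| <= A / eta) /\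
    forall h, `|h| <= eta ->
    `|g i (x + h) - g i x - dotv h l| <= A / eta ^+ 2 * `|h| ^+ 2.
  have [l [a [b [c [[a0 b0 c0] sA _ lb rc]]]]] := Tg i.
  (* As [a], [b * eta] and [c * eta ^+ 2] are nonnegative, each of them is at most [A]. *)
  have ? : 0 <= b * eta by rewrite mulr_ge0// ltW.
  have ? : 0 <= c * eta ^+ 2 by rewrite mulr_ge0// exprn_ge0// ltW.
  exists l; split=> [j|h /rc]; last first.
    move=> /le_trans; apply; rewrite ler_wpM2r ?exprn_ge0//.
    by rewrite ler_pdivlMr ?exprn_gt0//; lra.
  (* A coefficient is the value of the form at a basis vector, whose sup norm is at most 1. *)
  have -> : l 0 j = dotv (delta_mx 0 j) l.
    rewrite dotvE (bigD1 j)//= mxE !eqxx mul1r big1 ?addr0// => k kj.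
    by rewrite mxE (negbTE kj) andbF mul0r.
  apply: (le_trans (lb _)); apply: le_trans (_ : b * 1 <= _).
    rewrite ler_wpM2l// [leLHS]/Num.norm /= mx_normrE; apply/bigmax_leP; split => //= p _.
    by rewrite mxE; case: (_ && _); rewrite ?normr1 ?normr0.
  by rewrite mulr1 ler_pdivlMr//; lra.
have [l lP] := choice Tg.
have [U [UU FU]] := ultraFilterLemma FF.
have lU : UltraFilter (l @ U) := ultra_fmap _ _ l _ UU.
have cK : compact [set v : 'rV[R]_m | forall j, v 0 j \in `[- (A / eta), A / eta]].
  by apply: (@rV_compact _ _ (fun=> `[- (A / eta), A / eta]%classic)) => j;
    exact: segment_compact.
move: cK; rewrite compact_ultra => /(_ _ lU).
case=> [|L [_ lL]].
  apply: (@filterE _ U _ (l @^-1` _)) => i j; have [+ _] := lP i.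
  rewrite /= in_itv/= -ler_norml; exact.
exists L => h hh.
have gU y : `|y| <= eta -> g ^~ (x + y) @ U --> f (x + y).
  by move=> /gf; apply: cvg_trans; exact: cvg_app.
have gx : g ^~ x @ U --> f x.
  by have := gU 0; rewrite normr0 addr0; apply; rewrite ltW.
have dl : (fun i => dotv h (l i)) @ U --> dotv h L.
  rewrite dotvE; have -> : (fun i => dotv h (l i)) = fun i => \sum_j h 0 j * l i 0 j.
    by apply/funext => i; rewrite dotvE.
  apply: cvg_big => [|j _]; first exact: add_continuous.
  apply: cvgM; first exact: cvg_cst.
  exact: (cvg_comp _ _ lL (@coord_continuous _ _ _ 0 j L)).
have lim : (fun i => `|g i (x + h) - g i x - dotv h (l i)|) @ U -->
    `|f (x + h) - f x - dotv h L|.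
  by apply: cvg_norm; apply: cvgB => //; apply: cvgB => //; exact: gU.
rewrite -(cvg_lim (@Rhausdorff R) lim).
apply: limr_le; first by apply/cvg_ex; eexists; exact: lim.
by apply: nearW => i; have [_] := lP i; exact.
Qed.
Lemma quad_bound_le A A' g : A <= A' -> T A g x -> T A' g x.
Proof.
move=> AA' [l [a [b [c [? sA ? ? ?]]]]]; exists l, a, b, c; split => //.
exact: le_trans AA'.
Qed.
End quad.

(* The library declares this instance inside a section, where it stays local. *)
#[local] Existing Instance totally_filter.

(** * Absolute summability and differentiability of power series *)

(** Any two sums over finite supersets of a suitable [A0] differ by at most 2. Enlarging [A0] once
    by nonnegative terms and once by negative terms turns this into a bound on the absolute values
    outside [A0]. *)
Lemma cvg_partial_sum_bounded (R : realType) (I : choiceType) (t : I -> R) (l : R) :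
  partial_sum t @ totally --> l ->
  exists C : R, forall A, partial_sum (fun i => `|t i|) A <= C.
Proof.
move=> tl; have [A0 _ A0P] : \forall A \near totally, `|l - partial_sum t A| <= 1.
  by move/cvgrPdist_le : tl; apply; exact: ltr01.
pose S (u : I -> R) (A : {fset I}) := \sum_(i <- A) u i.
have SE u A : partial_sum u A = S u A by rewrite /S big_seq_fsetE.
exists (S (fun i => `|t i|) A0 + 2) => A; rewrite SE.
pose D := (A0 `|` A)%fset.
pose P := [fset i in D | (i \in A0) || (0 <= t i)]%fset.
pose Q := [fset i in D | (i \in A0) || (t i < 0)]%fset.
have SPQ : S t P - S t Q <= 2.
  have sub (p : pred I) : (A0 `<=` [fset i in D | (i \in A0) || p i])%fset.
    by apply/fsubsetP => i iA0; rewrite !inE iA0.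
  have := A0P P (sub _); have := A0P Q (sub _); rewrite /= !SE !ler_norml.
  by move=> /andP[? ?] /andP[? ?]; lra.
(* The terms of [A0] cancel between [P] and [Q]; every other term of [D] contributes its absolute
   value. *)
have SD : S (fun i => `|t i|) D = S (fun i => `|t i|) A0 + (S t P - S t Q).
  have -> : S (fun i => `|t i|) A0 = \sum_(i <- D | i \in A0) `|t i|.
    rewrite big_fset_condE; apply: eq_fbigl => i.
    by rewrite !inE/= orbC andbC; case: (i \in A0); rewrite ?orbT.
  rewrite /S /P /Q !big_fset/= [X in _ = X + _]big_mkcond [X in _ + (X - _)]big_mkcond.
  rewrite [X in _ - X]big_mkcond/=.
  rewrite -sumrB -big_split/=.
  apply: eq_bigr => i _; case: (i \in A0) => /=; first by rewrite subrr addr0.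
  by rewrite add0r; case: (ltrgt0P (t i)); lra.
apply: (@le_trans _ _ (S (fun i => `|t i|) D)); last by rewrite SD lerD2l.
rewrite /S [leRHS](big_fsetID _ (mem A))/=.
rewrite (_ : \sum_(i <- A) _ = \sum_(i <- [fset x in D | x \in A]%fset) `|t i|).
  by rewrite lerDl sumr_ge0.
by apply: eq_fbigl => i; rewrite !inE/= andbC; case: (i \in A); rewrite ?orbT.
Qed.

(** Absolute convergence at a single diagonal point gives all finite partial sums the same constant
    [C] in [quad_bound], at every point of a smaller ball. *)
Lemma analytic_differentiable (R : realType) m (f : 'rV[R]_m -> R) a :
  analytic_at f a -> \forall x \near a, differentiable f x.
Proof.
move=> [c] /nbhs_normP[d /= d0 cf].
(* The diagonal point [a + const_mx (s + s)], and all points [y + h] with [y] within [s] of [a] and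
   [|h| <= s], stay within [2 s < d] of [a]. *)
pose s := d / 4; have s0 : 0 < s by rewrite divr_gt0.
have [C CP] : exists C : R, forall A, partial_sum
    (fun k : {ffun 'I_m -> nat} => `|c k * monomial (const_mx (s + s)) k|) A <= C.
  apply: (cvg_partial_sum_bounded _ _ _ (f (a + const_mx (s + s)))).
  have := cf (a + const_mx (s + s)); rewrite addrAC subrr add0r; apply => /=.
  rewrite opprD addrA subrr add0r normrN; apply: (@le_lt_trans _ _ (s + s)).
    rewrite [leLHS]/Num.norm /= mx_normrE; apply/bigmax_leP; split => [|p _]/=.
      by rewrite addr_ge0 ?ltW.
    by rewrite mxE ger0_norm// addr_ge0 ?ltW.
  by rewrite /s; lra.
apply/nbhs_normP; exists s => //= y /=; rewrite distrC => ys.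
have TA A : quad_bound s C (fun z => partial_sum (fun k => c k * monomial z k) A) (y - a).
  apply: quad_bound_le (CP A) _; rewrite /partial_sum.
  apply: quad_bound_sum => // k; rewrite normrM.
  apply: quad_bound_le (quad_boundZ _ _ _ _ _ (quad_bound_monomial _ _ _ s _ _)) => //.
    by rewrite ler_wpM2l// ler_norm.
  exact: ltW.
(* The monomials are now centred at the origin, hence the translate of [f] and the base point
   [y - a]. *)
have [|l lP] := quad_bound_lim s (y - a) s0 _ totally _ C (f \o (+%R a)) TA.
  move=> h hs; have := cf (a + (y - a + h)); rewrite /= [a + _]addrC addrK; apply.
  rewrite opprD addrCA subrr addr0 normrN (le_lt_trans (ler_normD _ _))//.
  by move: ys hs; rewrite /s; lra.
have dlin : linear (fun v => dotv v l).
  by move=> k u v; rewrite /dotv mulmxDl -scalemxAl !mxE.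
pose L : {linear 'rV[R]_m -> R} :=
  HB.pack (fun v => dotv v l) (GRing.isLinear.Build _ _ _ _ _ dlin).
apply: (@differentiable_quadratic _ _ _ _ _ L (C / s ^+ 2)).
  exact: dotv_continuous.
have hs : \forall h \near (0 : 'rV[R]_m), `|h| <= s by exact: (nbhs0_le s0).
near=> h; have /= := lP h; rewrite addrA !subrKC; apply.
by near: h; exact: hs.
Unshelve. all: by end_near. Qed.

Lemma differentiable_rV (R : numFieldType) (V : normedModType R) n
    (f : V -> 'rV[R]_n) x :
  (forall j, differentiable (fun y => f y 0 j) x) -> differentiable f x.
Proof.
move=> df.
have -> : f = \sum_j (fun y => f y 0 j *: delta_mx 0 j).
  by apply/funext => y; rewrite fct_sumE [LHS]row_sum_delta.
by apply: differentiable_sum => j; exact: differentiableZl.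
Qed.

(** * Jacobians and Milnor sets of compositions *)

Section jacobian.
Context {R : realType}.

Lemma jacobianE m n (f : 'rV[R]_m -> 'rV[R]_n) x i j : differentiable f x ->
  'J f x i j = 'D_(delta_mx 0 i) (fun y => f y 0 j) x.
Proof.
move=> df; have := deriveEjacobian (delta_mx 0 i) df.
rewrite -rowE derive_mx; last exact: diff_derivable.
by move=> /rowP /(_ j); rewrite !mxE.
Qed.

Lemma jacobian_row_mx m n p (f : 'rV[R]_m -> 'rV[R]_n) (g : 'rV[R]_m -> 'rV[R]_p) x :
  differentiable f x -> differentiable g x ->
  'J (fun y => row_mx (f y) (g y)) x = row_mx ('J f x) ('J g x).
Proof.
move=> df dg.
have dfg : differentiable (fun y => row_mx (f y) (g y)) x.
  apply: differentiable_rV => j; case: (split_ordP j) => k ->.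
    under eq_fun do rewrite row_mxEl.
    exact: (differentiable_comp df (differentiable_coord (f x) 0 k)).
  under eq_fun do rewrite row_mxEr.
  exact: (differentiable_comp dg (differentiable_coord (g x) 0 k)).
apply/matrixP => i j; rewrite jacobianE//; case: (split_ordP j) => k ->.
  by rewrite row_mxEl jacobianE//; under eq_fun do rewrite row_mxEl.
by rewrite row_mxEr jacobianE//; under eq_fun do rewrite row_mxEr.
Qed.

Lemma jacobian_comp m n p (f : 'rV[R]_m -> 'rV[R]_n) (g : 'rV[R]_n -> 'rV[R]_p) x :
  differentiable f x -> differentiable g (f x) ->
  'J (g \o f) x = 'J f x *m 'J g (f x).
Proof.
move=> df dg; apply/row_matrixP => i; rewrite !rowE mulmxA.
by rewrite /jacobian !mul_rV_lin1 diff_comp.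
Qed.

Lemma differentiable_rhoE m (x : 'rV[R]_m) : differentiable (@rhoE R m) x.
Proof.
have -> : @rhoE R m = \sum_(i < m) (fun y : 'rV[R]_m => y 0 i) ^+ 2.
  by apply/funext => y; rewrite fct_sumE.
apply: differentiable_sum => i; apply: differentiableX.
exact: differentiable_coord.
Qed.

(** By the chain rule for row vectors, the Jacobian of [(g \o f, rhoE)] is that of [(f, rhoE)] times
    the block diagonal matrix of ['J g (f x)] and 1. If both factors have a left inverse, so does
    the product; the claim is the contrapositive. *)
Lemma Milnor_comp m n p (f : 'rV[R]_m -> 'rV[R]_n) (g : 'rV[R]_n -> 'rV[R]_p) x :
  differentiable f x -> differentiable g (f x) ->
  ~ Sing g (f x) -> Milnor_set (g \o f) x -> Milnor_set f x.
Proof.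
move=> df dg; rewrite /Milnor_set /Sing/=.
have drho : differentiable (fun y => (rhoE y)%:M : 'rV[R]_1) x.
  apply: differentiable_rV => j.
  rewrite (_ : (fun _ => _) = @rhoE R m); first exact: differentiable_rhoE.
  by apply/funext => y; rewrite ord1 mxE eqxx mulr1n.
rewrite !jacobian_row_mx//; last exact: differentiable_comp.
have -> : 'J (fun y => g (f y)) x = 'J f x *m 'J g (f x) by exact: jacobian_comp.
set A := 'J f x; set B := 'J g (f x); set r := 'J (fun y => (rhoE y)%:M) x.
(* In the transposed convention the columns count the target dimension, so being a submersion means
   [row_full], that is, having a left inverse. *)
have fullE k l (C : 'M[R]_(k, l)) : row_full C = ~~ (\rank C < l)%N.
  by rewrite -leqNgt /row_full eqn_leq rank_leq_col.
move=> /negP; rewrite -fullE => /row_fullP[B' B'B]; apply: contraTT.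
rewrite -!fullE => /row_fullP[A' A'A]; apply/row_fullP.
exists (block_mx B' 0 0 1%:M *m A').
have -> : row_mx (A *m B) r = row_mx A r *m block_mx B 0 0 1%:M.
  by rewrite mul_row_block !mulmx0 mulmx1 addr0 add0r.
rewrite mulmxA -[_ *m A' *m _]mulmxA A'A mulmx1 mulmx_block.
by rewrite B'B !mulmx0 !mul0mx mulmx1 !addr0 add0r -scalar_mx_block.
Qed.
End jacobian.

(** * Germs at the origin and tameness of the composition *)

Lemma analytic_germ_differentiable {R : realType} {m n} {f : 'rV[R]_m -> 'rV[R]_n} :
  analytic_germ f -> \forall x \near 0, differentiable f x.
Proof.
move=> [_ fa _].
have H : \forall x \near (0 : 'rV[R]_m), forall j, differentiable (fun y => f y 0 j) x.
  by apply: (filter_forall (F := nbhs (0 : 'rV[R]_m))) => j;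
    exact: analytic_differentiable.
by apply: filterS H => x; exact: differentiable_rV.
Qed.

(** Neighbourhoods are those of the sup norm; the Euclidean ball is reached through the continuity
    of [rhoE]. *)
Lemma near_closed_Eball (R : realType) m (e : R) : 0 < e ->
  \forall x \near (0 : 'rV[R]_m), closed_Eball e x.
Proof.
move=> e0.
have rc : {for (0 : 'rV[R]_m), continuous (fun y : 'rV[R]_m => Num.sqrt (rhoE y))}.
  apply: continuous_comp; last exact: sqrt_continuous.
  exact: differentiable_continuous (differentiable_rhoE m 0).
have rho0 : rhoE (0 : 'rV[R]_m) = 0.
  by rewrite /rhoE big1// => i _; rewrite mxE expr0n.
move/cvgrPdist_lt : rc => /(_ _ e0); rewrite /= rho0 sqrtr0; apply: filterS => x.
by rewrite /closed_Eball/= sub0r normrN => /ltW; apply: le_trans; exact: ler_norm.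
Qed.

Theorem proposition4p14 (R : realType) (M N K : nat)
    (hK : (2 <= K)%N) (hKN : (K <= N)%N) (hNM : (N <= M)%N)
    (F : 'rV[R]_M -> 'rV[R]_N) (G : 'rV[R]_N -> 'rV[R]_K)
    (hF : analytic_germ F) (hG : analytic_germ G)
    (tameF : tame F)
    (discF : isolated_critical_value F)
    (singG : germ_subset (Sing G) (zero_set G))
    (hMilnor : \forall eps \near (0 : R)^'+,
       germ_subset (F @` (Milnor_set (G \o F) `&` closed_Eball eps))
                   (Milnor_set G)) :
  tame G -> tame (G \o F).
Proof.
move=> tameG.
have [F0 _ _] := hF; have [G0 _ _] := hG.
have dF := analytic_germ_differentiable hF.
have dG := analytic_germ_differentiable hG.
have cF0 : F @ (0 : 'rV[R]_M) --> (0 : 'rV[R]_N).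
  suff : F @ (0 : 'rV[R]_M) --> F 0 by rewrite F0.
  exact: differentiable_continuous (nbhs_singleton dF).
have [e [e0 hMe]] : exists e : R, 0 < e /\
    germ_subset (F @` (Milnor_set (G \o F) `&` closed_Eball e)) (Milnor_set G).
  by near (0 : R)^'+ => e; exists e; split; near: e; [exact: nbhs_right_gt|].
(* Germ statements at the origin of the target become pointwise statements about [F x], valid for
   [x] near 0 because [F] tends to 0 there. *)
pose good x := [/\ differentiable F x, differentiable G (F x),
  Sing G (F x) -> zero_set G (F x) &
  Milnor_set (G \o F) x -> Milnor_set G (F x)].
have near_good : \forall x \near (0 : 'rV[R]_M), good x.
  near=> x; split.
  - by near: x.
  - by near: x; exact: cF0 dG.
  - by near: x; exact: cF0 singG.
  - move=> Mx; have : (F @` (Milnor_set (G \o F) `&` closed_Eball e)) (F x).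
      by exists x => //; split => //; near: x; exact: near_closed_Eball.
    by near: x; exact: cF0 hMe.
(* Closure at [p] is tested on neighbourhoods of [p], so [good] is needed around each [p] close to
   0. *)
have near_near := near_join near_good.
have tameGF := cF0 _ tameG.
rewrite /tame /germ_subset; near=> p => -[clp Hp].
have Fp_tame : (closure (Milnor_set F `\` zero_set F) `&` zero_set F) p -> [set 0] p.
  by near: p; exact: tameF.
have GFp_tame : (closure (Milnor_set G `\` zero_set G) `&` zero_set G) (F p) ->
    [set 0] (F p) by near: p; exact: tameGF.
have np : \forall x \near p, good x by near: p.
(* Neighbourhoods [W] of [F p] are pulled back by [F], and the points of [M(H)] off [V_H] found
   there are mapped into [M(G)] off [V_G]. *)
have Fp0 : F p = 0.
  apply: GFp_tame; split => // W WFp.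
  have [dFp _ _ _] := nbhs_singleton np.
  have WF : \forall x \near p, W (F x) by exact: differentiable_continuous dFp W WFp.
  have [x [[Mx Hx] [Wx [_ _ _ MG]]]] := clp _ (filterI WF np).
  by exists (F x); split => //; split => //; exact: MG.
(* It remains to see [p] as a limit of points of [M(F)] off [V_F]: the same [x] serve, since
   [G (F x) <> 0] excludes both [Sing G (F x)] and [F x = 0]. *)
apply: Fp_tame; split => // W Wp.
have [x [[Mx Hx] [Wx [dFx dGx sG _]]]] := clp _ (filterI Wp np).
exists x; split => //; split.
  by apply: Milnor_comp dFx dGx _ Mx => /sG.
by move=> Fx; apply: Hx; rewrite /zero_set/= Fx.
Unshelve. all: by end_near. Qed.
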